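(* For any fixed $d$, optimization over $DSOS_{n,2d}$ can be done with a linear program of size polynomial in $n$, and optimization over $SDSOS_{n,2d}$ can be done with a second order cone program of size polynomial in $n$.
   Context: A monomial in $x=(x_1,\ldots,x_n)$ is a function $m(x)=x_1^{\alpha_1}\cdots x_n^{\alpha_n}$ with each $\alpha_i$ a nonnegative integer. A polynomial $p$ is dsos if it can be written as $$p(x)=\sum_i \alpha_i m_i^2(x) + \sum_{i,j} \beta_{ij}^+ (m_i(x)+ m_j(x))^2+ \sum_{i,j} \beta_{ij}^- (m_i(x)- m_j(x))^2$$ (finite sums) for some monomials $m_i, m_j$ and some nonnegative scalars $\alpha_i,\beta_{ij}^+, \beta_{ij}^-$. It is sdsos if it can be written as $$p(x)=\sum_i \alpha_i m_i^2(x) + \sum_{i,j} (\hat{\beta}_{ij}^+ m_i(x)+ \tilde{\beta}_{ij}^+ m_j(x))^2+\sum_{i,j} (\hat{\beta}_{ij}^- m_i(x)- \tilde{\beta}_{ij}^- m_j(x))^2$$ (finite sums) for some monomials $m_i, m_j$ and some real scalars $\alpha_i, \hat{\beta}_{ij}^+, \tilde{\beta}_{ij}^+, \hat{\beta}_{ij}^-, \tilde{\beta}_{ij}^-$ with $\alpha_i \geq 0$. $DSOS_{n,2d}$ (resp. $SDSOS_{n,2d}$) denotes the set of polynomials in $n$ variables and degree $2d$ that are dsos (resp. sdsos), viewed as a cone in the space $\mathbb{R}^{\binom{n+2d}{2d}}$ of coefficient vectors of polynomials of degree at most $2d$. Optimization over such a set $K$ means optimizing a linear function of the coefficients of an unknown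 polynomial $p$ subject to affine constraints on these coefficients and the constraint $p\in K$. That this can be done with a linear program (resp. second order cone program) of size polynomial in $n$ means: the constraint $p\in K$ is equivalent to the existence of auxiliary real variables which, together with the coefficients of $p$, satisfy a system of linear equations and inequalities (resp. linear equations and inequalities and second order cone constraints, i.e. constraints of the form $\|u\|_2\le t$ with $u,t$ affine in the variables), where the number of auxiliary variables and constraints, and the dimensions of the constraints, are bounded by a polynomial in $n$ (for fixed $d$). *)

(* Defs.v *)
From HB Require Import structures.
From mathcomp Require Import all_boot all_order all_algebra.
From mathcomp Require Import reals.
From mathcomp Require Import mpoly.

Set Implicit Arguments.
Unset Strict Implicit.
Unset Printing Implicit Defensive.

Import Order.TTheory GRing.Theory Num.Theory.
Local Open Scope ring_scope.

Section Sos.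
Variables (R : realType) (n : nat).

(* The family m may repeat a monomial, so finitely many terms with the same
   pair of monomials are allowed in each of the sums. *)
Definition dsos (p : {mpoly R[n]}) : Prop :=
  exists (k : nat) (m : 'I_k -> 'X_{1..n})
         (alpha : 'I_k -> R) (betap betam : 'I_k -> 'I_k -> R),
    [/\ forall i, 0 <= alpha i,
        forall i j, 0 <= betap i j,
        forall i j, 0 <= betam i j &
        p = \sum_i alpha i *: 'X_[m i] ^+ 2
          + \sum_i \sum_j betap i j *: ('X_[m i] + 'X_[m j]) ^+ 2
          + \sum_i \sum_j betam i j *: ('X_[m i] - 'X_[m j]) ^+ 2].

Definition sdsos (p : {mpoly R[n]}) : Prop :=
  exists (k : nat) (m : 'I_k -> 'X_{1..n}) (alpha : 'I_k -> R)
         (hbetap tbetap hbetam tbetam : 'I_k -> 'I_k -> R),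
    (forall i, 0 <= alpha i) /\
    p = \sum_i alpha i *: 'X_[m i] ^+ 2
      + \sum_i \sum_j
          (hbetap i j *: 'X_[m i] + tbetap i j *: 'X_[m j]) ^+ 2
      + \sum_i \sum_j
          (hbetam i j *: 'X_[m i] - tbetam i j *: 'X_[m j]) ^+ 2.

(* msize is one more than the total degree, so these are the dsos (sdsos)
   polynomials of degree at most D. *)
Definition DSOS (D : nat) (p : {mpoly R[n]}) : Prop :=
  (msize p <= D.+1)%N /\ dsos p.

Definition SDSOS (D : nat) (p : {mpoly R[n]}) : Prop :=
  (msize p <= D.+1)%N /\ sdsos p.

(* 'X_{1..n < D.+1} is the finite type of the 'C(n + D, D) monomials of
   degree at most D. *)
Definition ncoef (D : nat) : nat := #|{: 'X_{1..n < D.+1}}|.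

Definition coefvec (D : nat) (p : {mpoly R[n]}) : 'cV[R]_(ncoef D) :=
  \col_(i < ncoef D) p@_(@enum_val 'X_{1..n < D.+1} predT i).

End Sos.

Section Programs.
Variable R : realType.

Definition norm2 (k : nat) (u : 'cV[R]_k) : R :=
  Num.sqrt (\sum_i u i 0 ^+ 2).

(* Constraints of a linear program in M real variables. *)
Record lin_system (M : nat) := LinSystem {
  neq : nat;
  eq_mx : 'M[R]_(neq, M);
  eq_rhs : 'cV[R]_neq;
  nineq : nat;
  ineq_mx : 'M[R]_(nineq, M);
  ineq_rhs : 'cV[R]_nineq
}.

Definition lin_sat (M : nat) (S : lin_system M) (z : 'cV[R]_M) : Prop :=
  eq_mx S *m z = eq_rhs S /\
  forall i, (ineq_mx S *m z) i 0 <= ineq_rhs S i 0.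

(* Constraints of a second order cone program in M real variables: the i-th
   cone constraint is |cone_mx i z + cone_cst i|_2 <= bnd_row i z + bnd_cst i,
   where the argument of the norm has dimension cone_dim i. *)
Record soc_system (M : nat) := SocSystem {
  lin_part : lin_system M;
  ncone : nat;
  cone_dim : 'I_ncone -> nat;
  cone_mx : forall i, 'M[R]_(cone_dim i, M);
  cone_cst : forall i, 'cV[R]_(cone_dim i);
  bnd_row : 'I_ncone -> 'rV[R]_M;
  bnd_cst : 'I_ncone -> R
}.

Definition soc_sat (M : nat) (S : soc_system M) (z : 'cV[R]_M) : Prop :=
  lin_sat (lin_part S) z /\
  forall i : 'I_(ncone S), norm2 (cone_mx i *m z + cone_cst i)
            <= (bnd_row i *m z) 0 0 + bnd_cst i.

(* In the next two definitions, k is the number of auxiliary variables y. *)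
Definition LP_representable (n D : nat) (K : {mpoly R[n]} -> Prop)
    (s : nat) : Prop :=
  exists (k : nat) (S : lin_system (ncoef n D + k)),
    [/\ (k <= s)%N, (neq S <= s)%N, (nineq S <= s)%N &
      forall p : {mpoly R[n]}, (msize p <= D.+1)%N ->
        (K p <-> exists y : 'cV[R]_k, lin_sat S (col_mx (coefvec D p) y))].

Definition SOCP_representable (n D : nat) (K : {mpoly R[n]} -> Prop)
    (s : nat) : Prop :=
  exists (k : nat) (S : soc_system (ncoef n D + k)),
    [/\ (k <= s)%N,
        [/\ (neq (lin_part S) <= s)%N, (nineq (lin_part S) <= s)%N &
            (ncone S <= s)%N],
        forall i : 'I_(ncone S), (cone_dim i <= s)%N &
      forall p : {mpoly R[n]}, (msize p <= D.+1)%N ->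
        (K p <-> exists y : 'cV[R]_k, soc_sat S (col_mx (coefvec D p) y))].

End Programs.

(* Main.v *)
Require Import Defs.
From mathcomp Require Import all_boot all_order all_algebra.
From mathcomp Require Import reals.
From mathcomp Require Import mpoly.
From mathcomp Require Import ring lra zify.

Set Implicit Arguments.
Unset Strict Implicit.
Unset Printing Implicit Defensive.

Import Order.TTheory GRing.Theory Num.Theory.
Local Open Scope ring_scope.

(** Membership in either cone is a statement about binomial squares
    (x X^m + y X^m')^2: a dsos polynomial is a sum of such squares with
    |x| = |y|, and an sdsos polynomial is a sum of such squares with arbitrary
    real x and y.  The representation may use monomials m, m' of any degree and
    any number of terms.  What makes a finite, small program possible is that
    for a polynomial of degree at most 2d only the monomials of degree at most d
    matter.  Leading terms cannot cancel in a sum of squares of real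
    polynomials, so every summand is the square of a polynomial of degree at
    most d ([sum_sqr_msize]); hence in each binomial the monomials of larger
    degree cancel or have coefficient zero, and may be deleted
    ([binomial_sos_low_degree]).

    Let B be the set of monomials of degree at most d.  The dsos polynomials of
    degree at most 2d are then the conic hull of the 2 |B|^2 squares
    (b + c)^2 and (b - c)^2, that is, a linear image of a nonnegative orthant
    ([dsos_orthant], [orthant_dsos]).  For the sdsos polynomials, the sums of
    squares of linear forms in two fixed monomials b and c are the quadratic
    forms given by positive semidefinite 2 x 2 matrices, and these form a
    three-dimensional Lorentz cone: the matrix with diagonal t + s, t - s and
    off-diagonal entry a is positive semidefinite iff |(s, a)|_2 <= t.  So the
    sdsos polynomials are a linear image of a product of |B|^2 Lorentz cones
    ([sdsos_lorentz], [lorentz_sdsos]).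

    A linear image of an orthant (of a product of Lorentz cones) is represented
    by a linear (second order cone) program whose auxiliary variables are the
    coordinates of the preimage and whose equations compare coefficients
    ([LP_orthant_image], [SOCP_lorentz_image]).  Its size is controlled by |B|
    and by the number of coefficients, and both are at most (n + D)^D for the
    degrees D = d and D = 2d ([ncoef_le]). *)

(** * Counting monomials *)

Lemma bin_le_expn (m k : nat) : ('C(m, k) <= m ^ k)%N.
Proof.
elim: k m => [|k IHk] m; first by rewrite bin0.
case: m => [|m]; first by rewrite bin0n.
rewrite -(leq_pmul2l (ltn0Sn k)) -mul_bin_diag expnS.
rewrite (leq_trans _ (leq_pmull _ (ltn0Sn k))) // leq_mul2l /=.
apply: leq_trans (IHk m) _.
by case: k {IHk} => // k; rewrite leq_exp2r.
Qed.

(** The exponent vectors of total degree at most D are the n-tuples over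
    0, ..., D with sum at most D, of which there are 'C(n + D, n). *)
Lemma ncoef_le (n D : nat) : (ncoef n D <= (n + D) ^ D)%N.
Proof.
rewrite (leq_trans _ (bin_le_expn _ _)) //.
have <- : 'C(n + D, n) = 'C(n + D, D) by rewrite -bin_sub ?leq_addr // addKn.
rewrite -card_partial_ord_partitions /ncoef.
pose f (m : 'X_{1..n < D.+1}) : n.-tuple 'I_D.+1 :=
  [tuple inord (bmnm m i) | i < n].
have fE (m : 'X_{1..n < D.+1}) i : tnth (f m) i = bmnm m i :> nat.
  rewrite tnth_mktuple inordK //.
  apply: leq_ltn_trans (bmdeg m).
  by rewrite mdegE (bigD1 i) //= leq_addr.
have f_inj : injective f.
  move=> m1 m2 eqf; apply/val_inj/mnmP => i.
  by rewrite -!fE eqf.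
rewrite -cardsT -(card_imset _ f_inj); apply: subset_leq_card.
apply/subsetP => _ /imsetP[m _ ->]; rewrite inE.
rewrite big_tuple (eq_bigr (fun i => bmnm m i)); last by move=> i _; exact: fE.
by rewrite -mdegE -ltnS bmdeg.
Qed.

(** * Reindexing finite sums *)

Lemma sum_prod (V : nmodType) (I J : finType) (F : I * J -> V) :
  \sum_t F t = \sum_i \sum_j F (i, j).
Proof. by rewrite pair_bigA; apply: eq_bigr => -[]. Qed.

Lemma sum_enum_val (V : nmodType) (T : finType) (F : T -> V) :
  \sum_t F t = \sum_(i < #|T|) F (enum_val i).
Proof. exact: (reindex _ (onW_bij _ (enum_val_bij T))). Qed.

(** * Degrees in sums of squares *)

Section Degree.
Variables (R : realType) (n : nat).
Implicit Types (p q : {mpoly R[n]}) (m : 'X_{1..n}).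

Lemma mcoeff_msize_le p m : (msize p <= mdeg m)%N -> p@_m = 0.
Proof. by move=> h; apply/eqP; rewrite mcoeff_eq0 msize_mdeg_ge. Qed.

Lemma msize_sqr_le q (d : nat) :
  (msize q <= d.+1)%N -> (msize (q ^+ 2) <= (2 * d).+1)%N.
Proof.
have [->|q0] := eqVneq q 0; first by rewrite expr0n /= msize0.
by rewrite expr2 msizeM //; case: (msize q) => [|k]; lia.
Qed.

(** Leading terms do not cancel: if L is the largest of the leading monomials
    of the q t, then the coefficient of L + L in the sum is the sum of the
    squares of the coefficients of L in the q t, and it is positive. *)
Lemma sum_sqr_msize (T : finType) (q : T -> {mpoly R[n]}) (d : nat) :
    (msize (\sum_t q t ^+ 2) <= (2 * d).+1)%N ->
  forall t, (msize (q t) <= d.+1)%N.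
Proof.
move=> le_d t0; rewrite leqNgt; apply/negP => lt_d.
have q0 : q t0 != 0 by apply: contraTneq lt_d => ->; rewrite msize0.
pose t1 := [arg max_(t > t0) mlead (q t)]%O.
have mle t : (mlead (q t) <= mlead (q t1))%O.
  by rewrite /t1; case: arg_maxP => // i _; exact.
set L := mlead (q t1) in mle.
have L_big : (d < mdeg L)%N.
  by apply: leq_trans (lemc_mdeg (mle t0)); rewrite -ltnS mlead_deg.
have := @mcoeff_msize_le (\sum_t q t ^+ 2) (L + L)%MM.
rewrite mdegD => /(_ ltac:(lia)).
rewrite raddf_sum /= => /eqP; rewrite psumr_eq0 => [|t _]; last first.
  by rewrite expr2 mleadcMW // -expr2 sqr_ge0.
move=> /allP/(_ t1 (mem_index_enum _)) /=.
rewrite expr2 mleadcMW // mulf_eq0 orbb mleadc_eq0 => /eqP q1.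
by move: L_big; rewrite /L q1 mlead0 mdeg0.
Qed.

End Degree.

(** * Sums of squares of binomials *)

Section BinomialSos.
Variables (R : realType) (n : nat).
Implicit Types (p q : {mpoly R[n]}) (m : 'X_{1..n}).

(** The relation A restricts the pairs of coefficients, so that the dsos and
    the sdsos polynomials are two instances of the same notion. *)
Definition binomial_sos (A : R -> R -> Prop) p : Prop :=
  exists (T : finType) (x y : T -> R) (m m' : T -> 'X_{1..n}),
    (forall t, A (x t) (y t)) /\
    p = \sum_t (x t *: 'X_[m t] + y t *: 'X_[m' t]) ^+ 2.

Definition same_abs (x y : R) : Prop := exists s : bool, y = (-1) ^+ s * x.

(** The terms of the three sums of a dsos or sdsos decomposition, merged into
    one index type. *)
Definition sos_index (I : finType) : finType := ((I + I * I) + I * I)%type.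

Definition sos_case (I : finType) (S : Type) (F : I -> S) (G H : I -> I -> S)
    (t : sos_index I) : S :=
  match t with
  | inl (inl i) => F i
  | inl (inr e) => G e.1 e.2
  | inr e => H e.1 e.2
  end.

Lemma sum_sos_case (V : nmodType) (I : finType) (F : I -> V)
    (G H : I -> I -> V) :
  \sum_i F i + \sum_i \sum_j G i j + \sum_i \sum_j H i j =
  \sum_(t : sos_index I) sos_case F G H t.
Proof. by rewrite !big_sumType /= !sum_prod. Qed.

Lemma sqrr_scaleD (c s : R) (u v : {mpoly R[n]}) : 0 <= c ->
  c *: (u + s *: v) ^+ 2 =
  (Num.sqrt c *: u + (s * Num.sqrt c) *: v) ^+ 2.
Proof.
by move=> c0; rewrite mulrC -scalerA -scalerDr exprZn sqr_sqrtr.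
Qed.

Lemma dsos_binomial_sos p : dsos p -> binomial_sos same_abs p.
Proof.
move=> [k [m [a [bp [bm [a0 bp0 bm0 ->]]]]]].
(* A monomial square is the binomial square of two equal monomials, up to
   the factor 4. *)
pose coef := sos_case (fun i => a i / 4) bp bm.
pose neg := sos_case (fun=> false) (fun _ _ => false) (fun _ _ : 'I_k => true).
pose fst_mon := sos_case m (fun i _ => m i) (fun i _ => m i).
pose snd_mon := sos_case m (fun _ j => m j) (fun _ j => m j).
exists _, (fun t => Num.sqrt (coef t)),
  (fun t => (-1) ^+ neg t * Num.sqrt (coef t)), fst_mon, snd_mon.
split=> [t|]; first by exists (neg t).
rewrite sum_sos_case; apply: eq_bigr => t _.
have c0 : 0 <= coef t.
  by case: t => [[i|e]|e] //=; rewrite divr_ge0.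
rewrite -sqrr_scaleD //; case: t {c0} => [[i|e]|e] /=.
- by rewrite scale1r -mulr2n exprMn_n -scaler_nat scalerA divfK // pnatr_eq0.
- by rewrite scale1r.
- by rewrite scaleN1r.
Qed.

Lemma sdsos_binomial_sos p : sdsos p -> binomial_sos (fun _ _ => True) p.
Proof.
move=> [k [m [a [hp [tp [hm [tm [a0 ->]]]]]]]].
pose x := sos_case (fun i => Num.sqrt (a i)) hp hm.
pose y := sos_case (fun=> 0) tp (fun i j => - tm i j).
pose fst_mon := sos_case m (fun i _ => m i) (fun i _ => m i).
pose snd_mon := sos_case m (fun _ j => m j) (fun _ j => m j).
exists _, x, y, fst_mon, snd_mon; split=> //.
rewrite sum_sos_case; apply: eq_bigr => -[[i|e]|e] _ //=.
- by rewrite scale0r addr0 exprZn sqr_sqrtr.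
- by rewrite scaleNr.
Qed.

(** The projection onto the polynomials of degree at most d, on monomials. *)
Definition low_part (d : nat) m : {mpoly R[n]} :=
  if (mdeg m < d.+1)%N then 'X_[m] else 0.

(** The left side is its own truncation to degree d, and truncation is linear.
    This also covers m = m' of large degree with x + y = 0, where neither
    coefficient vanishes. *)
Lemma low_part_eq (d : nat) (x y : R) m m' :
    (msize (x *: 'X_[m] + y *: 'X_[m'] : {mpoly R[n]}) <= d.+1)%N ->
  x *: 'X_[m] + y *: 'X_[m'] = x *: low_part d m + y *: low_part d m'.
Proof.
move=> le_d; apply/mpolyP => a.
have lowE b : (low_part d b)@_a = if (mdeg a <= d)%N then (b == a)%:R else 0.
  rewrite /low_part ltnS; have [<-|ne] := eqVneq b a.
    by case: ifP => _; rewrite ?mcoeffX ?mcoeff0 ?eqxx.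
  by case: ifP => _; rewrite ?mcoeffX ?mcoeff0 ?(negbTE ne) if_same.
have [gt_d|] := leqP d.+1 (mdeg a).
  rewrite (mcoeff_msize_le (leq_trans le_d gt_d)).
  by rewrite mcoeffD !mcoeffZ !lowE leqNgt gt_d /= !mulr0 addr0.
by rewrite ltnS => le_a; rewrite !mcoeffD !mcoeffZ !lowE le_a !mcoeffX.
Qed.

(** The monomial squares occur because truncating a binomial may delete one of
    its two monomials, after which the coefficients need not satisfy A. *)
Lemma binomial_sos_low_degree (A : R -> R -> Prop) (d : nat)
    (C : {mpoly R[n]} -> Prop) p :
    C 0 -> (forall q r, C q -> C r -> C (q + r)) ->
    (forall x y (b c : 'X_{1..n < d.+1}), A x y ->
       C ((x *: 'X_[b] + y *: 'X_[c]) ^+ 2)) ->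
    (forall (x : R) (b : 'X_{1..n < d.+1}), C ((x *: 'X_[b]) ^+ 2)) ->
  (msize p <= (2 * d).+1)%N -> binomial_sos A p -> C p.
Proof.
move=> C0 CD Cbin Cmon le_p [T [x [y [m [m' [Axy def_p]]]]]].
rewrite def_p in le_p *; apply: (big_ind C) => // t _.
rewrite (low_part_eq (sum_sqr_msize le_p t)) /low_part.
case: ifP => h; case: ifP => h'.
- exact: (Cbin _ _ (BMultinom h) (BMultinom h')).
- by rewrite scaler0 addr0; exact: (Cmon _ (BMultinom h)).
- by rewrite scaler0 add0r; exact: (Cmon _ (BMultinom h')).
- by rewrite !scaler0 addr0 expr0n.
Qed.

End BinomialSos.

(** * Linear images of cones as linear and second order cone programs *)

Section LinearImage.
Variables (R : realType) (n : nat) (T : finType).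
Implicit Types (P : (T -> R) -> Prop) (g : T -> {mpoly R[n]}).

Definition lin_image P g (p : {mpoly R[n]}) : Prop :=
  exists c, P c /\ p = \sum_t c t *: g t.

Lemma lin_image0 P g : P (fun=> 0) -> lin_image P g 0.
Proof.
move=> P0; exists (fun=> 0); split=> //.
by rewrite big1 // => t _; rewrite scale0r.
Qed.

Lemma lin_imageD P g p q :
    (forall a b, P a -> P b -> P (fun t => a t + b t)) ->
  lin_image P g p -> lin_image P g q -> lin_image P g (p + q).
Proof.
move=> PD [a [Pa ->]] [b [Pb ->]]; exists (fun t => a t + b t).
split; first exact: PD.
by rewrite -big_split; apply: eq_bigr => t _; rewrite scalerDl.
Qed.

Variable D : nat.

Definition coord (y : 'cV[R]_#|T|) (t : T) : R := y (enum_rank t) 0.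

Definition gen_mx g : 'M[R]_(ncoef n D, #|T|) :=
  \matrix_(i, j) coefvec D (g (enum_val j)) i 0.

Lemma coefvec_inj p q : (msize p <= D.+1)%N -> (msize q <= D.+1)%N ->
  coefvec D p = coefvec D q -> p = q :> {mpoly R[n]}.
Proof.
move=> le_p le_q /colP eq_pq; rewrite (mpolywE le_p) (mpolywE le_q).
apply: eq_bigr => b _; congr (_ *: _).
by have := eq_pq (enum_rank b); rewrite !mxE enum_rankK.
Qed.

Lemma coefvec_lin_comb g y :
  coefvec D (\sum_t coord y t *: g t) = gen_mx g *m y.
Proof.
apply/colP => i; rewrite !mxE raddf_sum /= sum_enum_val.
apply: eq_bigr => j _.
by rewrite mcoeffZ !mxE /coord enum_valK mulrC.
Qed.

(** For the variables (coefvec p, y): the polynomial p has the same coefficients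
    as the combination of the generators with weights y, and A y <= 0. *)
Definition comb_system (k : nat) (A : 'M[R]_(k, #|T|)) g :
    lin_system R (ncoef n D + #|T|) :=
  LinSystem (row_mx 1%:M (- gen_mx g)) 0 (row_mx 0 A) 0.

Lemma comb_systemP k (A : 'M[R]_(k, #|T|)) g p y :
    (forall t, (msize (g t) <= D.+1)%N) -> (msize p <= D.+1)%N ->
  lin_sat (comb_system A g) (col_mx (coefvec D p) y) <->
  p = \sum_t coord y t *: g t /\ forall i, (A *m y) i 0 <= 0.
Proof.
move=> le_g le_p; rewrite /lin_sat /= !mul_row_col mul1mx mulNmx mul0mx add0r.
have le_s : (msize (\sum_t coord y t *: g t) <= D.+1)%N.
  apply: leq_trans (msize_sum _ _ _) _; apply/bigmax_leqP => t _.
  exact: leq_trans (msizeZ_le _ _) (le_g t).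
rewrite -coefvec_lin_comb; split=> -[eq_p Ay].
  split; last by move=> i; have := Ay i; rewrite [leRHS]mxE.
  by apply: coefvec_inj le_p le_s _; apply/eqP; rewrite -subr_eq0 eq_p.
split; first by rewrite {1}eq_p subrr.
by move=> i; rewrite [leRHS]mxE.
Qed.

Lemma coord_surj (c : T -> R) : exists y, coord y =1 c.
Proof.
by exists (\col_i c (enum_val i)) => t; rewrite /coord mxE enum_rankK.
Qed.

End LinearImage.

Definition orthant (R : realType) (T : finType) (c : T -> R) : Prop :=
  forall t, 0 <= c t.

Lemma LP_orthant_image (R : realType) (n D s : nat) (T : finType)
    (g : T -> {mpoly R[n]}) (K : {mpoly R[n]} -> Prop) :
    (forall t, (msize (g t) <= D.+1)%N) ->
    (#|T| <= s)%N -> (ncoef n D <= s)%N ->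
    (forall p, (msize p <= D.+1)%N ->
       (K p <-> lin_image (@orthant R T) g p)) ->
  LP_representable D K s.
Proof.
move=> le_g le_T le_D defK.
exists #|T|, (comb_system D (- 1%:M) g); split=> // p le_p.
rewrite (defK p le_p); split=> [[c [c0 def_p]]|[y]].
  have [y yE] := coord_surj c; exists y; apply/comb_systemP => //.
  split; first by rewrite def_p; apply: eq_bigr => t _; rewrite yE.
  move=> i; rewrite mulNmx mul1mx mxE oppr_le0.
  by have := c0 (enum_val i); rewrite -yE /coord enum_valK.
case/comb_systemP => // def_p y0; exists (coord y); split=> // t.
by have := y0 (enum_rank t); rewrite mulNmx mul1mx mxE oppr_le0.
Qed.

(** A product of Lorentz cones of dimension r + 1, indexed by E. *)
Definition lorentz (R : realType) (r : nat) (E : finType)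
    (c : 'I_r.+1 * E -> R) : Prop :=
  forall e, norm2 (\col_(l < r) c (lift ord0 l, e)) <= c (ord0, e).

Lemma SOCP_lorentz_image (R : realType) (n D s r : nat) (E : finType)
    (g : 'I_r.+1 * E -> {mpoly R[n]}) (K : {mpoly R[n]} -> Prop) :
    (forall t, (msize (g t) <= D.+1)%N) ->
    (r.+1 * #|E| <= s)%N -> (ncoef n D <= s)%N -> (r <= s)%N ->
    (forall p, (msize p <= D.+1)%N ->
       (K p <-> lin_image (@lorentz R r E) g p)) ->
  SOCP_representable D K s.
Proof.
move=> le_g le_E le_D le_r defK; set T := ('I_r.+1 * E)%type in g le_g defK *.
have cardT : #|{: T}| = (r.+1 * #|E|)%N by rewrite card_prod card_ord.
(* The row vector that reads off the auxiliary variable (l, e). *)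
pose sel (e : 'I_#|E|) (l : 'I_r.+1) : 'rV[R]_(ncoef n D + #|{: T}|) :=
  row_mx 0 (delta_mx 0 (enum_rank (l, enum_val e))).
pose S := @SocSystem R _ (comb_system D (0 : 'M_(0, _)) g) #|E| (fun=> r)
  (fun e => \matrix_l sel e (lift ord0 l)) (fun=> 0)
  (fun e => sel e ord0) (fun=> 0).
exists #|{: T}|, S.
split=> //=; first by rewrite cardT.
  by split=> //; apply: leq_trans le_E; rewrite leq_pmull.
have selE p y e l : (sel e l *m col_mx (coefvec D p) y) 0 0 =
    coord y (l, enum_val e).
  by rewrite mul_row_col mul0mx add0r -rowE mxE.
have satE p y : (msize p <= D.+1)%N ->
    (soc_sat S (col_mx (coefvec D p) y) <->
     p = \sum_t coord y t *: g t /\ lorentz (coord y)).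
  move=> le_p; rewrite /soc_sat /= comb_systemP //.
  have normE (e : 'I_#|E|) :
      (\matrix_l sel e (lift ord0 l)) *m col_mx (coefvec D p) y + 0 =
      \col_l coord y (lift ord0 l, enum_val e).
    rewrite addr0; apply/colP => l; rewrite [RHS]mxE -(selE p).
    by rewrite -(rowK (fun l => sel e (lift ord0 l)) l) -row_mul [RHS]mxE.
  split=> [[[def_p _] cone]|[def_p cone]]; split=> //.
  - move=> e; have := cone (enum_rank e).
    by rewrite normE selE enum_rankK addr0.
  - by split=> // -[].
  - by move=> e; rewrite normE selE addr0.
move=> p le_p; rewrite (defK p le_p); split=> [[c [c0 def_p]]|[y]].
  have [y yE] := coord_surj c; exists y; apply/satE => //.
  split; first by rewrite def_p; apply: eq_bigr => t _; rewrite yE.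
  move=> e; have := c0 e; rewrite yE; congr (norm2 _ <= _).
  by apply/colP => l; rewrite !mxE yE.
by case/satE => // def_p cone; exists (coord y).
Qed.

(** * The dsos and sdsos cones *)

Section Cones.
Variables (R : realType) (n d : nat).
Local Notation B := 'X_{1..n < d.+1}.

Definition dsos_gen (t : bool * (B * B)) : {mpoly R[n]} :=
  ('X_[t.2.1] + (-1) ^+ t.1 *: 'X_[t.2.2]) ^+ 2.

Lemma msize_low_comb (x y : R) (b c : B) :
  (msize (x *: 'X_[b] + y *: 'X_[c] : {mpoly R[n]}) <= d.+1)%N.
Proof.
apply: leq_trans (msizeD_le _ _) _; rewrite geq_max.
by apply/andP; split; apply: leq_trans (msizeZ_le _ _) _; rewrite msizeX bmdeg.
Qed.

Lemma msize_dsos_gen t : (msize (dsos_gen t) <= (2 * d).+1)%N.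
Proof. by apply: msize_sqr_le; rewrite -['X_[t.2.1]]scale1r msize_low_comb. Qed.

(** After truncation each summand is x^2 (b + c)^2, x^2 (b - c)^2 or x^2 b^2,
    and b^2 is a quarter of (b + b)^2. *)
Lemma dsos_orthant p : (msize p <= (2 * d).+1)%N -> dsos p ->
  lin_image (@orthant R _) dsos_gen p.
Proof.
have PD (a b : bool * (B * B) -> R) :
    orthant a -> orthant b -> orthant (fun t => a t + b t).
  by move=> a0 b0 t; rewrite addr_ge0 ?a0 ?b0.
have gen (c0 : R) t0 : 0 <= c0 ->
    lin_image (@orthant R _) dsos_gen (c0 *: dsos_gen t0).
  move=> c0_ge0; exists (fun t => if t == t0 then c0 else 0); split.
    by move=> t; case: ifP.
  rewrite (bigD1 t0) //= eqxx big1 ?addr0 // => t /negbTE ->.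
  by rewrite scale0r.
move=> le_p /dsos_binomial_sos; apply: binomial_sos_low_degree le_p.
- by apply: lin_image0 => t.
- by move=> q r; apply: lin_imageD.
- move=> x y b c [s ->].
  have -> : (x *: 'X_[b] + ((-1) ^+ s * x) *: 'X_[c]) ^+ 2
      = x ^+ 2 *: dsos_gen (s, (b, c)).
    by rewrite /dsos_gen -exprZn scalerDr scalerA (mulrC x).
  by apply: gen; rewrite sqr_ge0.
- move=> x b.
  have -> : (x *: 'X_[b]) ^+ 2 = (x / 2) ^+ 2 *: dsos_gen (false, (b, b)).
    by rewrite /dsos_gen /= scale1r -exprZn -mulr2n -scaler_nat scalerA
      divfK ?pnatr_eq0.
  by apply: gen; rewrite sqr_ge0.
Qed.

Lemma orthant_dsos p : lin_image (@orthant R _) dsos_gen p -> dsos p.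
Proof.
move=> [c [c0 ->]].
pose m (i : 'I_#|{: B}|) : 'X_{1..n} := enum_val i.
exists #|{: B}|, m, (fun=> 0), (fun i j => c (false, (enum_val i, enum_val j))),
  (fun i j => c (true, (enum_val i, enum_val j))).
split=> //.
have pairE s : \sum_e c (s, e) *: dsos_gen (s, e) =
    \sum_i \sum_j c (s, (enum_val i, enum_val j)) *:
      ('X_[m i] + (-1) ^+ s *: 'X_[m j]) ^+ 2.
  rewrite sum_prod.
  rewrite sum_enum_val /=.
  by apply: eq_bigr => i _; rewrite sum_enum_val.
rewrite [X in X + _ + _]big1 ?add0r => [|i _]; last by rewrite scale0r.
rewrite sum_prod big_bool /=.
rewrite !pairE addrC; congr (_ + _);
  apply: eq_bigr => i _; apply: eq_bigr => j _.
  by rewrite scale1r.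
by rewrite scaleN1r.
Qed.

(** A quadratic form u b^2 + 2 a b c + v c^2 in the coordinates t = (u + v) / 2,
    s = (u - v) / 2 and a, in which it is positive semidefinite exactly on the
    Lorentz cone s^2 + a^2 <= t^2, t >= 0. *)
Definition sdsos_gen (t : 'I_3 * (B * B)) : {mpoly R[n]} :=
  let: (l, (b, c)) := t in
  nth 0 [:: 'X_[b] ^+ 2 + 'X_[c] ^+ 2; 'X_[b] ^+ 2 - 'X_[c] ^+ 2;
            ('X_[b] * 'X_[c]) *+ 2] l.

Lemma msize_sdsos_gen t : (msize (sdsos_gen t) <= (2 * d).+1)%N.
Proof.
have le_mul (b c : B) :
    (msize ('X_[b] * 'X_[c] : {mpoly R[n]}) <= (2 * d).+1)%N.
  rewrite -mpolyXD msizeX mdegD; have := bmdeg b; have := bmdeg c.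
  by rewrite !ltnS => *; rewrite mul2n -addnn leq_add.
have le_add (p q : {mpoly R[n]}) : (msize p <= (2 * d).+1)%N ->
    (msize q <= (2 * d).+1)%N -> (msize (p + q) <= (2 * d).+1)%N.
  by move=> le_p le_q; apply: leq_trans (msizeD_le _ _) _; rewrite geq_max le_p.
case: t => -[[|[|[|//]]] ?] [b c] /=; apply: le_add; rewrite ?msizeN ?le_mul //.
Qed.

Lemma sum_sdsos_gen (c : 'I_3 * (B * B) -> R) :
  \sum_t c t *: sdsos_gen t =
  \sum_e (c (ord0, e) *: ('X_[e.1] ^+ 2 + 'X_[e.2] ^+ 2) +
     (c (lift ord0 ord0, e) *: ('X_[e.1] ^+ 2 - 'X_[e.2] ^+ 2) +
      c (lift ord0 (lift ord0 ord0), e) *: ('X_[e.1] * 'X_[e.2] *+ 2))).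
Proof.
rewrite sum_prod exchange_big /=.
by apply: eq_bigr => -[b b'] _; rewrite !big_ord_recl big_ord0 addr0.
Qed.

Lemma lorentz3P (E : finType) (c : 'I_3 * E -> R) : lorentz c <->
  forall e, 0 <= c (ord0, e) /\
    c (lift ord0 ord0, e) ^+ 2 + c (lift ord0 (lift ord0 ord0), e) ^+ 2 <=
    c (ord0, e) ^+ 2.
Proof.
have step e : norm2 (\col_(l < 2) c (lift ord0 l, e)) <= c (ord0, e) <->
    0 <= c (ord0, e) /\
    c (lift ord0 ord0, e) ^+ 2 + c (lift ord0 (lift ord0 ord0), e) ^+ 2 <=
    c (ord0, e) ^+ 2.
  rewrite /norm2 !big_ord_recl big_ord0 addr0 !mxE.
  set a := _ + _; have a0 : 0 <= a by rewrite addr_ge0 ?sqr_ge0.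
  split=> [le_c|[c0 le_c]].
    have c0 := le_trans (sqrtr_ge0 _) le_c; split=> //.
    by rewrite -(sqr_sqrtr a0) ler_sqr ?nnegrE ?sqrtr_ge0.
  by rewrite -(ler_sqr (sqrtr_ge0 _) c0) sqr_sqrtr.
by split=> h e; apply/step.
Qed.

(** The triangle inequality for the Euclidean norm of the plane, from
    Cauchy-Schwarz by Lagrange's identity. *)
Lemma lorentz3D (E : finType) (a b : 'I_3 * E -> R) :
  lorentz a -> lorentz b -> lorentz (fun t => a t + b t).
Proof.
move=> /lorentz3P la /lorentz3P lb; apply/lorentz3P => e.
have [a0 le_a] := la e; have [b0 le_b] := lb e.
split; first exact: addr_ge0.
set a1 := a (lift _ _, e) in le_a *.
set a2 := a (lift _ (lift _ _), e) in le_a *.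
set b1 := b (lift _ _, e) in le_b *.
set b2 := b (lift _ (lift _ _), e) in le_b *.
set t := a (_, e) in a0 le_a *; set s := b (_, e) in b0 le_b *.
suff : a1 * b1 + a2 * b2 <= t * s by nra.
apply: le_trans (ler_norm _) _.
rewrite -ler_sqr ?nnegrE ?mulr_ge0 // real_normK ?num_real //.
apply: (@le_trans _ _ ((a1 ^+ 2 + a2 ^+ 2) * (b1 ^+ 2 + b2 ^+ 2))).
  by rewrite -subr_ge0 (_ : _ - _ = (a1 * b2 - a2 * b1) ^+ 2) ?sqr_ge0 //; ring.
by rewrite exprMn ler_pM // addr_ge0 ?sqr_ge0.
Qed.

(** Compares the form with parameters t, b, a, whose matrix has the diagonal
    t + b, t - b and the off-diagonal entry a, with the sum of squares that a
    triangular factorization of this matrix provides. *)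
Lemma lorentz_form (t b a x y z : R) (u v : {mpoly R[n]}) :
    x ^+ 2 = t + b -> x * y = a -> y ^+ 2 + z ^+ 2 = t - b ->
  t *: (u ^+ 2 + v ^+ 2) + (b *: (u ^+ 2 - v ^+ 2) + a *: (u * v *+ 2)) =
  (x *: u + y *: v) ^+ 2 + (z *: v) ^+ 2.
Proof.
move=> tDb <- tBb.
transitivity ((t + b) *: u ^+ 2 + (t - b) *: v ^+ 2 + (x * y) *: (u * v *+ 2)).
  by rewrite -!mul_mpolyC; rewrite !mpolyCD !mpolyCN; ring.
by rewrite -tDb -tBb -!mul_mpolyC !mpolyCD !expr2 !mpolyCM; ring.
Qed.

(** The square (x b + y c)^2 is the form with the matrix of rank one made of
    x^2, x y and y^2, which lies on the boundary of the Lorentz cone of the pair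
    (b, c). *)
Lemma sdsos_lorentz p : (msize p <= (2 * d).+1)%N -> sdsos p ->
  lin_image (@lorentz R 2 _) sdsos_gen p.
Proof.
have gen (x y : R) (b c : B) :
    lin_image (@lorentz R 2 _) sdsos_gen ((x *: 'X_[b] + y *: 'X_[c]) ^+ 2).
  pose v (l : 'I_3) : R :=
    nth 0 [:: (x ^+ 2 + y ^+ 2) / 2; (x ^+ 2 - y ^+ 2) / 2; x * y] l.
  exists (fun t => if t.2 == (b, c) then v t.1 else 0); split.
    apply/lorentz3P => e /=; case: ifP => _; last by rewrite expr0n /= addr0.
    rewrite /v /=; split; first by rewrite divr_ge0 // addr_ge0 ?sqr_ge0.
    by rewrite le_eqVlt; apply/orP; left; apply/eqP; field.
  rewrite sum_sdsos_gen (bigD1 (b, c)) //= eqxx.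
  rewrite [X in _ = _ + X]big1 ?addr0 => [|e /negbTE ->]; last first.
    by rewrite !scale0r !addr0.
  rewrite /v /= (@lorentz_form _ _ _ x y 0); [|by field|by []|by field].
  by rewrite scale0r expr0n addr0.
move=> le_p /sdsos_binomial_sos; apply: binomial_sos_low_degree le_p.
- apply: lin_image0; apply/lorentz3P => e.
  by rewrite expr0n /= addr0.
- by move=> q r; apply: lin_imageD; exact: lorentz3D.
- by move=> x y b c _; exact: gen.
- by move=> x b; have := gen x 0 b b; rewrite scale0r addr0.
Qed.

(** The Cholesky factorization of a positive semidefinite 2 x 2 matrix with
    diagonal t + b, t - b and off-diagonal entry a.  If the pivot t + b is zero,
    then a = 0, because a^2 <= (t + b) (t - b). *)
Lemma lorentz_factor (t b a : R) : 0 <= t -> b ^+ 2 + a ^+ 2 <= t ^+ 2 ->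
  exists x : R * R * R, [/\ x.1.1 ^+ 2 = t + b, x.1.1 * x.1.2 = a &
    x.1.2 ^+ 2 + x.2 ^+ 2 = t - b].
Proof.
move=> t0 le_t.
have u0 : 0 <= t + b by nra.
have v0 : 0 <= t - b by nra.
have [u_eq0|u_neq0] := eqVneq (t + b) 0.
  exists (0, 0, Num.sqrt (t - b)) => /=.
  split; rewrite ?expr0n ?mul0r ?add0r ?sqr_sqrtr //.
  by apply/esym/eqP; rewrite -sqrf_eq0; apply/eqP; nra.
have u_gt0 : 0 < t + b by rewrite lt0r u_neq0.
exists (Num.sqrt (t + b), a / Num.sqrt (t + b),
        Num.sqrt (t - b - a ^+ 2 / (t + b))) => /=.
split.
- by rewrite sqr_sqrtr.
- by rewrite mulrC divfK // gt_eqF // sqrtr_gt0.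
- rewrite exprMn exprVn !sqr_sqrtr //; first by rewrite addrC subrK.
  rewrite subr_ge0 ler_pdivrMr //; nra.
Qed.

(** Each Lorentz cone contributes two squares by [lorentz_factor]: a binomial
    one, and a monomial one, which is placed in the sum of the differences with
    first coefficient 0. *)
Lemma lorentz_sdsos p : lin_image (@lorentz R 2 _) sdsos_gen p -> sdsos p.
Proof.
move=> [c [/lorentz3P c_lor ->]].
have /fin_all_exists[w wP] e := lorentz_factor (c_lor e).1 (c_lor e).2.
pose m (i : 'I_#|{: B}|) : 'X_{1..n} := enum_val i.
pose e (i j : 'I_#|{: B}|) : B * B := (enum_val i, enum_val j).
exists #|{: B}|, m, (fun=> 0), (fun i j => (w (e i j)).1.1),
  (fun i j => (w (e i j)).1.2), (fun _ _ => 0), (fun i j => (w (e i j)).2).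
split=> //.
rewrite [X in X + _ + _]big1 ?add0r => [|i _]; last by rewrite scale0r.
rewrite sum_sdsos_gen -big_split /=.
under eq_bigr => e' _.
  have [tDb ab tBb] := wP e'; rewrite (lorentz_form _ _ tDb ab tBb); over.
rewrite sum_prod sum_enum_val /=.
apply: eq_bigr => i _; rewrite sum_enum_val /=.
rewrite -big_split; apply: eq_bigr => j _.
by rewrite scale0r sub0r sqrrN.
Qed.

End Cones.

(** * Polynomial size *)

Theorem theorem3p9 (R : realType) (d : nat) :
  (exists q : {poly nat}, forall n : nat,
     LP_representable (2 * d) (@DSOS R n (2 * d)) q.[n]) /\
  (exists q : {poly nat}, forall n : nat,
     SOCP_representable (2 * d) (@SDSOS R n (2 * d)) q.[n]).
Proof.
pose bound D : {poly nat} := ('X + D%:P) ^+ D.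
have boundE D n : (bound D).[n] = ((n + D) ^ D)%N.
  by rewrite /bound horner_exp hornerD hornerX hornerC.
have card_le n :
    (#|{: 'X_{1..n < d.+1} * 'X_{1..n < d.+1}}| <= (bound d).[n] ^ 2)%N.
  by rewrite card_prod boundE leq_mul // ncoef_le.
split.
  exists (2%:P * bound d ^+ 2 + bound (2 * d)) => n.
  rewrite hornerD hornerCM horner_exp boundE.
  apply: (LP_orthant_image (g := @dsos_gen R n d)).
  - exact: msize_dsos_gen.
  - by rewrite card_prod card_bool; apply: leq_trans (leq_addr _ _);
      rewrite leq_mul2l card_le.
  - by apply: leq_trans (leq_addl _ _); exact: ncoef_le.
  move=> p le_p; split=> [[_ dsos_p]|]; first exact: dsos_orthant.
  by move/orthant_dsos.
exists (3%:P * bound d ^+ 2 + bound (2 * d) + 2%:P) => n.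
rewrite !hornerD hornerC hornerCM horner_exp boundE.
apply: (SOCP_lorentz_image (g := @sdsos_gen R n d)).
- exact: msize_sdsos_gen.
- by rewrite -addrA; apply: leq_trans (leq_addr _ _); rewrite leq_mul2l card_le.
- rewrite addrAC; apply: leq_trans (leq_addl _ _); exact: ncoef_le.
- exact: leq_addl.
move=> p le_p; split=> [[_ sdsos_p]|]; first exact: sdsos_lorentz.
by move/lorentz_sdsos.
Qed.
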